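(* Let $(X,\mathcal U)$ be a uniform space. Consider the following conditions: (a) for each $U\in\mathcal U$ there are a bounded set $B\subset X$ and $n\in\mathbb N$ such that $X\setminus U^n[B]$ is uniformly isolated; (b) for every $f\in U(X)$ there is $k\ge 0$ such that $\{x\in X:|f(x)|\ge k\}$ is uniformly isolated; (c) every unbounded set in $X$ contains an infinite uniformly isolated subset. Then (a) $\Rightarrow$ (b) $\Rightarrow$ (c). If $(X,\mathcal U)$ is $\beta$-defavorable, then the three conditions are equivalent.
   Context: Uniform spaces are Hausdorff, given by their filters $\mathcal U$ of entourages; all $U\in\mathcal U$ considered are assumed open and symmetric. $\mathbb N$ denotes the positive integers. $U(X)$ is the set of real-valued uniformly continuous functions on $X$. For $U\in\mathcal U$, $F\subset X$, $n\in\mathbb N$: $U^n=U\circ\cdots\circ U$ ($n$ times), $U[F]=\{x\in X:(x,y)\in U\text{ for some }y\in F\}$ and $U[x]=U[\{x\}]$. A set $B\subset X$ is (Bourbaki) bounded in $X$ if every $f\in U(X)$ is bounded on $B$ (equivalently, for every $U\in\mathcal U$ there are $n\in\mathbb N$ and a finite $F\subset X$ with $B\subset U^n[F]$); otherwise it is unbounded. A set $A\subset X$ is uniformly isolated in $(X,\mathcal U)$ if there is $U\in\mathcal U$ with $U[x]=\{x\}$ for every $x\in A$. The game $\mathcal J(D)$: let $D$ be a dense subset of $X\times X$ (with $X$ carrying the topology induced by $\mathcal U$). Two players $\alpha$ and $\beta$ play a game of length $\omega$. Player $\alpha$ moves first, choosing $W_0\in\mathcal U$, and Player $\beta$ answers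 with a point $(x_0,y_0)\in W_0\cap D$. At stage $n$, Player $\alpha$ chooses $W_n\in\mathcal U$ and then Player $\beta$ chooses $(x_n,y_n)\in W_n\cap D$. Player $\alpha$ wins the play $(W_n,(x_n,y_n))_n$ if for every infinite set $I$ of indices and every $U\in\mathcal U$ there are indices $n,m$ such that $\{n,m\}\cap I\neq\emptyset$ and $(x_n,y_m)\in U$; otherwise Player $\beta$ wins. The uniform space $(X,\mathcal U)$ is $\beta$-defavorable if there is a dense set $D\subset X\times X$ such that Player $\beta$ has no winning strategy in $\mathcal J(D)$. *)

(* Defs.v *)
From HB Require Import structures.
From mathcomp Require Import all_boot all_order all_algebra.
From mathcomp Require Import all_classical all_reals all_analysis.
Import Order.TTheory GRing.Theory Num.Theory numFieldNormedType.Exports.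

Set Implicit Arguments.
Unset Strict Implicit.
Unset Printing Implicit Defensive.

Local Open Scope classical_set_scope.
Local Open Scope ring_scope.

(* Every entourage quantified over below is open and symmetric; openness is in
   the product topology of X * X. *)
Definition open_sym_entourage (X : uniformType) (U : set (X * X)) : Prop :=
  [/\ entourage U, open U & (U^-1)%relation = U].

(* The 0-th power is the diagonal; only the powers with 0 < n are used. *)
Definition ent_pow (X : Type) (U : set (X * X)) (n : nat) : set (X * X) :=
  iter n (fun V => (U \; V)%relation) diagonal.

(* U[F] *)
Definition ent_image (X : Type) (U : set (X * X)) (F : set X) : set X :=
  [set x | exists2 y, F y & U (x, y)].

Definition bourbaki_bounded (R : realType) (X : uniformType) (B : set X) :
  Prop := forall f : X -> R, unif_continuous f -> [bounded f x | x in B].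

Definition uniformly_isolated (X : uniformType) (A : set X) : Prop :=
  exists2 U : set (X * X), open_sym_entourage U &
    forall x, A x -> ent_image U [set x] = [set x].

(* The outcome depends only on the points z n = (x_n, y_n). *)
Definition alpha_wins (X : uniformType) (z : nat -> X * X) : Prop :=
  forall (I : set nat) (U : set (X * X)),
    infinite_set I -> open_sym_entourage U ->
    exists n m : nat, [set n; m] `&` I !=set0 /\ U ((z n).1, (z m).2).

(* A strategy maps the list of the completed stages (W_i, (x_i, y_i)), i < n,
   and the current move W_n of alpha to a point. *)
Definition beta_strategy (X : uniformType) : Type :=
  seq (set (X * X) * (X * X)) -> set (X * X) -> X * X.

(* The answers of beta have to be legal, and alpha must not win, in every play
   in which beta follows sigma. *)
Definition beta_winning (X : uniformType) (D : set (X * X))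
    (sigma : beta_strategy X) : Prop :=
  forall (W : nat -> set (X * X)) (z : nat -> X * X),
    (forall n, open_sym_entourage (W n)) ->
    (forall n, z n = sigma (mkseq (fun i => (W i, z i)) n) (W n)) ->
    (forall n, (W n `&` D) (z n)) /\ ~ alpha_wins z.

Definition beta_defavorable (X : uniformType) : Prop :=
  exists2 D : set (X * X), dense D &
    ~ exists sigma : beta_strategy X, beta_winning D sigma.

Definition cond_a (R : realType) (X : uniformType) : Prop :=
  forall U : set (X * X), open_sym_entourage U ->
    exists (B : set X) (n : nat),
      [/\ bourbaki_bounded R B, (0 < n)%N &
          uniformly_isolated (~` ent_image (ent_pow U n) B)].

Definition cond_b (R : realType) (X : uniformType) : Prop :=
  forall f : X -> R, unif_continuous f ->
    exists2 k : R, 0 <= k & uniformly_isolated [set x | k <= `|f x|].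

Definition cond_c (R : realType) (X : uniformType) : Prop :=
  forall A : set X, ~ bourbaki_bounded R A ->
    exists C : set X, [/\ C `<=` A, infinite_set C & uniformly_isolated C].

(* Main.v *)
(* A function with [|f x - f y| < 1] on [U] is bounded on [U^n[B]] for bounded
   [B], hence (a) => (b); (b) => (c) is immediate.

   For (c) => (a), let [U] violate (a). Finite sets are bounded, so outside
   [U^n[F]], for [F] the finite set of points played so far, some [x] has
   [W]-close points [y <> x]; by density beta can answer with such a pair
   [(x_n, y_n)] in [D]. Against every finite number of steps of [U] the pairs
   drift apart, so some uniformly continuous function tends to infinity along
   both [x_n] and [y_n]. If (c) holds, two extractions give an infinite [J] and an
   entourage [V] isolating all [x_n] and [y_n] with [n] in [J]; for [n] or [m] in
   [J], [V (x_n, y_m)] then forces [x_n = y_m], which the choice of the pairs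
   excludes. So beta wins for every dense [D]. *)
Require Import Defs.
From mathcomp Require Import all_boot all_order all_algebra.
From mathcomp Require Import all_classical all_reals all_analysis.
From mathcomp Require Import lra zify.
Import Order.TTheory GRing.Theory Num.Theory numFieldNormedType.Exports.

Set Implicit Arguments.
Unset Strict Implicit.
Unset Printing Implicit Defensive.

Local Open Scope classical_set_scope.
Local Open Scope ring_scope.

Section UniformSpace.
Context {R : realType} {X : uniformType}.
Implicit Types (U V W D : set (X * X)) (A B : set X) (f h : X -> R).

(** * Construction of uniformly continuous functions *)

Lemma unif_continuous_realP f : unif_continuous f <->
  forall e : R, 0 < e -> entourage [set p : X * X | `|f p.1 - f p.2| < e].
Proof.
split=> [fU e e0|fU E].
  have /fU : entourage [set p : R * R | ball p.1 e p.2].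
    exact: (entourage_ball _ (PosNum e0)).
  by [].
rewrite /= -entourage_ballE => -[e /= e0 eE].
apply: filterS (fU e e0) => -[x y] /= xy.
by apply: eE.
Qed.

(** For nonempty [A], [h] is the distance to [A] in the gauge pseudometric of [V], truncated at a
    radius [eps] whose balls lie within [V], then divided by [eps]. *)
Lemma unif_separation A B V : entourage V ->
  (forall x y, A x -> B y -> ~ V (x, y)) ->
  exists h : X -> R, [/\ unif_continuous h, forall x, 0 <= h x <= 1,
    forall x, A x -> h x = 0 & forall x, B x -> h x = 1].
Proof.
move=> entV ABV.
have [A0|/set0P[a Aa]] := eqVneq A set0.
  exists (fun=> 1); split=> //.
  - apply/unif_continuous_realP => e e0.
    by apply: filterS filterT => p _ /=; rewrite subrr normr0.
  - by move=> x; rewrite ler01 lexx.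
  - by move=> x; rewrite A0.
pose T : pseudoMetricType R := gauge.type entV.
(* The gauge uniformity is coarser than that of [X], so uniform continuity for it passes to [X]. *)
have entT (E : set (T * T)) : entourage E -> @entourage X E.
  exact: gauge.gauge_ent.
have [eps eps0 epsV] : exists2 eps : R, 0 < eps &
    forall x y : T, ball x eps y -> V (x, y).
  have : @entourage T V by exists O => //= ? [].
  by rewrite -entourage_ballE => -[e /= e0 eV]; exists e => // x y /(eV (x, y)).
pose d (x : T) := @edist_inf R T A x.
have dfin x : d x \is a fin_num.
  rewrite ge0_fin_numE ?edist_inf_ge0 //.
  apply: (@le_lt_trans _ _ (edist (x, a : T))).
    by apply: ereal_inf_lbound; exists a.
  (* Balls of radius 2 are the whole space. *)
  rewrite -ge0_fin_numE ?edist_ge0 //; apply/edist_finP => /=; exists 2 => //.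
  exact: countable_uniform.countable_uniform_bounded.
have dball (x y : T) r : 0 < r -> ball x r y -> fine (d x) <= r + fine (d y).
  move=> r0 xy; rewrite -lee_fin EFinD !fineK //.
  apply: le_trans (edist_inf_triangle _ x y) _.
  by rewrite leeD2r // edist_fin.
have d_ge0 x : 0 <= fine (d x) by rewrite fine_ge0 // edist_inf_ge0.
exists (fun x => Num.min (fine (d x)) eps / eps); split.
- apply/unif_continuous_realP => e e0.
  (* The half makes the weak bound from [dball] strict. *)
  have ee0 : 0 < e * eps / 2 by rewrite divr_gt0 // mulr_gt0.
  have /entT : entourage [set p : T * T | ball p.1 (e * eps / 2) p.2].
    exact: (entourage_ball _ (PosNum ee0)).
  apply: (@filterS _ (@entourage X)) => -[x y] /= xy.
  rewrite -mulrBl normrM [`|eps^-1|]gtr0_norm ?invr_gt0 // ltr_pdivrMr //.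
  have h1 := dball _ _ _ ee0 xy.
  have h2 := dball _ _ _ ee0 (ball_sym xy).
  move: ee0 h1 h2; rewrite /Num.min ltr_norml.
  move: (fine (d x)) (fine (d y)) (e * eps) => u v w.
  by case: (ltP u) => ?; case: (ltP v) => ? *; apply/andP; split; lra.
- move=> x; apply/andP; split.
    by rewrite divr_ge0 ?le_min ?d_ge0 ?ltW.
  by rewrite ler_pdivrMr // mul1r ge_min lexx orbT.
- by move=> x Ax; rewrite /d edist_inf0 // min_l ?mul0r //= ltW.
- move=> x Bx; rewrite min_r ?divff ?gt_eqF // leNgt; apply/negP.
  rewrite -lte_fin fineK // => /ereal_inf_lt[_ [z Az <-]] xz.
  by apply: (ABV z x) => //; apply/epsV/ball_sym/(@edist_lt_ball R T _ (x, z)).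
Qed.

(* The unit steps of [N] along [V] are smoothed with a single separating
   function [h], which is 0 where [N = 0 mod 4] and 1 where [N = 2 mod 4]: run
   upwards on the residues 0, 1, 2 and downwards on 2, 3, 0, it glues to a
   function whose increments along [V] are those of [h] up to sign. *)
Lemma unif_continuous_of_coarse (N : X -> nat) V : entourage V ->
  (forall x y, V (x, y) -> (N x <= (N y).+1)%N /\ (N y <= (N x).+1)%N) ->
  exists2 f : X -> R, unif_continuous f & forall x, (N x)%:R <= 2 * f x + 4.
Proof.
move=> entV NV.
have [|h [hU h01 h0 h1]] := @unif_separation [set x | (N x %% 4 = 0)%N]
    [set x | (N x %% 4 = 2)%N] V entV.
  by move=> x y /= ? ? /NV; lia.
pose f x := if (N x %% 4 == 3)%N then 2 * (N x %/ 4)%N%:R + 2 - h x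
            else 2 * (N x %/ 4)%N%:R + h x.
have fstep x y : N y = N x \/ N y = (N x).+1 -> `|f x - f y| = `|h x - h y|.
  move=> Nxy; rewrite /f; case: Nxy => Nxy.
    rewrite Nxy; case: eqP => _; last by congr `| _ |; lra.
    by rewrite distrC; congr `| _ |; lra.
  case: eqP => [x3|x3].
    have -> : (N y %/ 4 = (N x %/ 4).+1)%N by lia.
    have y0 : (N y %% 4 = 0)%N by lia.
    rewrite y0 /= (h0 y) // -natr1 -normrN; congr `| _ |; lra.
  have -> : (N y %/ 4 = N x %/ 4)%N by lia.
  case: eqP => [y3|y3]; last by congr `| _ |; lra.
  rewrite (h1 x) /=; last by lia.
  by rewrite -normrN; congr `| _ |; lra.
exists f.
  apply/unif_continuous_realP => e e0.
  have he := (unif_continuous_realP h).1 hU e e0.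
  apply: filterS (filterI entV he) => -[x y] [/= /NV[xy yx]].
  have [|yltx] := leqP (N x) (N y).
    by move=> xley; rewrite fstep //; lia.
  by rewrite distrC [`|f x - _|]distrC fstep //; lia.
move=> x; have /andP[hx0 hx1] := h01 x.
(* [f] gains 2 per block of four values of [N], hence the factor 2; the summand 4 covers the
   incomplete block. *)
have : (N x)%:R <= (4 * (N x %/ 4) + 4)%N%:R :> R by rewrite ler_nat; lia.
rewrite natrD natrM /f; case: ifP => _; lra.
Qed.

(** * Entourages, their chains, and bounded sets *)

Lemma open_sym_swap U x y : open_sym_entourage U -> U (x, y) -> U (y, x).
Proof. by case=> _ _ US Uxy; rewrite -US. Qed.

Lemma open_sym_entourageI U V : open_sym_entourage U ->
  open_sym_entourage V -> open_sym_entourage (U `&` V).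
Proof.
move=> [eU oU sU] [eV oV sV]; split; [exact: filterI|exact: openI|].
by rewrite -[in RHS]sU -[in RHS]sV.
Qed.

Lemma unif_continuous_open_sym f e : unif_continuous f -> 0 < e ->
  exists2 U, open_sym_entourage U & forall x y, U (x, y) -> `|f x - f y| < e.
Proof.
move=> /unif_continuous_realP fU e0.
pose E := [set p : X * X | `|f p.1 - f p.2| < e].
have entE : entourage E by exact: fU.
have symE : (E^-1)%relation = E.
  by apply/seteqP; split=> -[x y]; rewrite /E /= distrC.
exists E => //; split=> //; rewrite openE => -[x y]; rewrite /E /= => xy.
pose r := (e - `|f x - f y|) / 2.
have r0 : 0 < r by rewrite divr_gt0 // subr_gt0.
pose ball_r (t : X) := xsection [set p : X * X | `|f p.1 - f p.2| < r] t.
exists (ball_r x, ball_r y); first by split; apply: nbhs_entourage; exact: fU.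
move=> [s t] /= []; rewrite /ball_r /xsection /= !inE /= => xs yt.
have := ler_distD (f x) (f s) (f t); have := ler_distD (f y) (f x) (f t).
by rewrite (distrC (f s) (f x)); move: xs yt; rewrite /r; lra.
Qed.

Lemma ent_powSl U n x y z :
  U (x, z) -> ent_pow U n (z, y) -> ent_pow U n.+1 (x, y).
Proof.
move=> xz; elim: n y => [|n IH] y /=.
  by move=> /diagonalP <-; exists x.
by move=> [w /= /IH xw wy]; exists w.
Qed.

Lemma ent_powW U m n x y : entourage U -> (m <= n)%N ->
  ent_pow U m (x, y) -> ent_pow U n (x, y).
Proof.
move=> entU /subnK <-; elim: (n - m)%N => //= k IH /IH xy.
by exists y => //; exact: entourage_refl.
Qed.

Lemma ent_pow_dist f U n x y :
  (forall x y, U (x, y) -> `|f x - f y| < 1) ->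
  ent_pow U n (x, y) -> `|f x - f y| <= n%:R.
Proof.
move=> fU; elim: n y => [|n IH] y /=.
  by move=> /diagonalP ->; rewrite subrr normr0.
move=> [z /= /IH xz /fU zy]; rewrite -natr1.
have := ler_distD (f z) (f x) (f y); lra.
Qed.

Lemma bourbaki_boundedP A : bourbaki_bounded R A <->
  forall f, unif_continuous f -> exists M : R, forall x, A x -> `|f x| <= M.
Proof.
split=> H f fU; have := H f fU.
  by move=> /pinfty_ex_gt0[M _ AM]; exists M.
move=> [M AM]; exists M; split=> [|K MK x Ax /=]; first exact: num_real.
exact: le_trans (AM x Ax) (ltW MK).
Qed.

Lemma bourbaki_bounded_seq (s : seq X) : bourbaki_bounded R [set x | x \in s].
Proof.
apply/bourbaki_boundedP => f _; exists (\sum_(y <- s) `|f y|) => x /= xs.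
by rewrite (big_rem x) //= lerDl sumr_ge0.
Qed.

(* The layers [S n] drift apart by ever longer [U]-chains, so the least [m] such
   that [x] is reached by an [m]-chain from some [S i], [i <= m], is [n] on
   [S n]. *)
Lemma unif_continuous_of_drifting (S : nat -> set X) U :
  open_sym_entourage U ->
  (forall i n p q, (i < n)%N -> S i p -> S n q -> ~ ent_pow U n (q, p)) ->
  exists2 f : X -> R, unif_continuous f &
    forall n x, S n x -> n%:R <= 2 * f x + 4.
Proof.
move=> oU Sfar; have entU : entourage U by case: oU.
pose A m := [set x | exists i p, [/\ (i <= m)%N, S i p & ent_pow U m (x, p)]].
have Astep m x y : U (y, x) -> A m x -> A m.+1 y.
  by move=> yx [i [p [im Sp xp]]]; exists i, p; split; [lia| |exact: ent_powSl xp].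
(* The default 0 off all [A m] respects unit steps: by [Astep], a [U]-neighbour of such a point is
   again off all [A m]. *)
have /choice[N NP] : forall x, exists n : nat,
    (forall m, A m x -> A n x /\ (n <= m)%N) /\
    ((forall m, ~ A m x) -> n = 0%N).
  move=> x; have [[m0 Am0]|nA] := pselect (exists m, A m x); last first.
    by exists 0%N; split=> // m Am; case: nA; exists m.
  have ex : exists m, `[< A m x >] by exists m0; apply/asboolP.
  case: (ex_minnP ex) => n /asboolP An nmin; exists n; split.
    by move=> m Am; split=> //; apply: nmin; apply/asboolP.
  by move=> /(_ m0).
have Nle x y : U (x, y) -> (N x <= (N y).+1)%N.
  move=> xy; have [[m Ay]|nA] := pselect (exists m, A m y).
    have [/(Astep _ _ _ xy) Ax _] := (NP y).1 m Ay.
    by have [] := (NP x).1 _ Ax.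
  rewrite (NP x).2 // => m Ax; apply: nA; exists m.+1.
  exact: Astep (open_sym_swap oU xy) Ax.
have [f fU Nf] := unif_continuous_of_coarse entU
  (fun x y xy => conj (Nle x y xy) (Nle y x (open_sym_swap oU xy))).
exists f => // n x Sx; apply: le_trans (Nf x); rewrite ler_nat leqNgt.
apply/negP => Nn.
have Ax : A n x by exists n, x; split=> //; exact: (@ent_powW _ 0%N).
have [[i [p [iN Sp xp]]] _] := (NP x).1 n Ax.
apply: (Sfar i n p x) => //; first lia.
exact: ent_powW (ltnW Nn) xp.
Qed.

(** * The implications from (a) to (b) and from (b) to (c) *)

Lemma cond_a_b : cond_a R X -> cond_b R X.
Proof.
move=> aX f fU.
have [U oU Uf] := unif_continuous_open_sym fU ltr01.
have [B [n [/bourbaki_boundedP/(_ _ fU)[M BM] _ [V oV Viso]]]] := aX U oU.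
(* On [U^n[B]] the bound [M] grows by at most 1 per step, so [|f|] stays below this level there. *)
exists (Num.max 0 (M + n%:R + 1)); first by rewrite le_max lexx.
exists V => // x /= xk; apply: Viso => -[y By /(ent_pow_dist Uf) xy].
have := BM y By.
have : M + n%:R + 1 <= `|f x| by apply: le_trans xk; rewrite le_max lexx orbT.
have := lerB_dist (f x) (f y); lra.
Qed.

Lemma cond_b_c : cond_b R X -> cond_c R X.
Proof.
move=> bX A /bourbaki_boundedP; apply: contra_notP => nC f fU.
have [k k0 [U oU Uiso]] := bX f fU.
pose C := A `&` [set x | k <= `|f x|].
have [/finite_seqP[s sC]|infC] := pselect (finite_set C); last first.
  exfalso; apply: nC; exists C; split; [by move=> x []|by []|].
  by exists U => // x [_ /Uiso].
(* [k] bounds [|f|] off [C], the sum bounds it on the finite set [C]. *)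
exists (k + \sum_(y <- s) `|f y|) => x Ax.
have s0 : 0 <= \sum_(y <- s) `|f y| by rewrite sumr_ge0.
have [kx|/ltW kx] := leP k `|f x|; last lra.
have xs : x \in s by have : C x by []; rewrite sC.
have : `|f x| <= \sum_(y <- s) `|f y|.
  by rewrite (big_rem x) //= lerDl sumr_ge0.
lra.
Qed.

(** * The game: from (c) and a failure of (a) to a winning strategy of beta *)

(** A pair of distinct close points is moved into [D]; the Hausdorff property keeps the coordinates
    distinct. The second one is reached from [x] by two [U]-steps, through [y], which costs the two
    extra powers. *)
Lemma beta_move D U A n W : hausdorff_space X -> dense D ->
  open_sym_entourage U -> open_sym_entourage W ->
  ~ uniformly_isolated (~` ent_image (ent_pow U n.+2) A) ->
  exists z, [/\ (W `&` D) z, z.1 <> z.2,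
    ~ ent_image (ent_pow U n) A z.1 & ~ ent_image (ent_pow U n) A z.2].
Proof.
move=> hX dD oU oW niso.
have [x [y [xA xy Wxy Uxy]]] : exists x y,
    [/\ ~ ent_image (ent_pow U n.+2) A x, x <> y, W (x, y) & U (x, y)].
  have oWU := open_sym_entourageI oW oU.
  apply: contra_notP niso => nex; exists (W `&` U) => // x xA.
  apply/seteqP; split=> [y [_ /= -> ] yx|_ /= ->]; last first.
    by exists x => //; apply: entourage_refl; case: oWU.
  apply: contra_notP nex => /= /nesym ?; exists x, y.
  by have [] := open_sym_swap oWU yx; split.
have entU : entourage U by case: oU.
have nbW : nbhs (x, y) W by case: oW => _ + _; rewrite openE; exact.
have nbU (t : X) : nbhs t [set s | U (t, s)].
  by have := nbhs_entourage t entU; apply: filterS => s; rewrite /xsection /= inE.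
have [S [oS Sxy SP]] : exists S : set (X * X), [/\ open S, S (x, y) &
    forall p, S p -> [/\ W p, p.1 <> p.2, U (x, p.1) & U (y, p.2)]].
  move/eqP: xy => xy.
  have := hX; rewrite open_hausdorff => /(_ x y xy)[[P Q] /=].
  move=> [/set_mem Px /set_mem Qy] [oP oQ /eqP PQ].
  pose G := W `&` ((P `&` [set s | U (x, s)]) `*` (Q `&` [set s | U (y, s)])).
  have nG : nbhs (x, y) G.
    apply: filterI => //; exists (P `&` [set s | U (x, s)], Q `&` [set s | U (y, s)]) => //.
    by split; apply: filterI => //; exact: open_nbhs_nbhs.
  exists G°; split=> //; first exact: open_interior.
  move=> [s t] /interior_subset[Wst [[/= Ps xs] [Qt yt]]]; split=> // st.
  suff : (P `&` Q) s by rewrite PQ.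
  by split=> //; rewrite st.
have [|z [Sz Dz]] := dD S _ oS; first by exists (x, y).
have [Wz z12 xz yz] := SP z Sz; exists z; split=> //.
- move=> [p Ap zp]; apply: xA; exists p => //.
  by apply: (@ent_powW _ n.+1) => //; exact: ent_powSl zp.
- by move=> [p Ap zp]; apply: xA; exists p => //; exact: ent_powSl Uxy (ent_powSl yz zp).
Qed.

Lemma not_alpha_wins U (z : nat -> X * X) : cond_c R X ->
  open_sym_entourage U -> (forall n, (z n).1 <> (z n).2) ->
  (forall i n p q, (i < n)%N -> [set (z i).1; (z i).2] p ->
     [set (z n).1; (z n).2] q -> ~ ent_pow U n.+1 (q, p)) ->
  ~ alpha_wins z.
Proof.
move=> cX oU z12 zfar; have entU : entourage U by case: oU.
have [|f fU fz] := @unif_continuous_of_drifting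
    (fun n => [set (z n).1; (z n).2]) U oU.
  by move=> i n p q lin zp zq /(ent_powW entU (leqnSn n)); exact: zfar lin zp zq.
(* One extraction: (c) is applied to the image of [I] under [u], and the isolated set is pulled back
   to indices. *)
have sub_iso (I : set nat) (u : nat -> X) : infinite_set I ->
    (forall n, [set (z n).1; (z n).2] (u n)) ->
    exists J V, [/\ J `<=` I, infinite_set J, open_sym_entourage V &
      forall n x, J n -> V (x, u n) -> x = u n].
  move=> infI uz.
  have [|C [CI infC [V oV Viso]]] := cX (u @` I).
    move=> /bourbaki_boundedP/(_ _ fU)[M fM]; apply: infI.
    (* By [fz], a bound [M] for [f] on the image bounds every index in [I] by [2 * M + 4]. *)
    apply: (@sub_finite_set _ _ `I_(Num.truncn (2 * M + 4)).+1).
      move=> n In /=; rewrite ltnS.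
      have := fM (u n) (ex_intro2 _ _ n In erefl).
      have := fz n _ (uz n); have := ler_norm (f (u n)) => h1 h2 h3.
      have nM : n%:R <= 2 * M + 4 by lra.
      by rewrite truncn_ge_nat // (le_trans (ler0n R n)).
    exact: finite_II.
  exists (I `&` u @^-1` C), V; split=> //.
  - move=> finJ; apply: infC; apply: sub_finite_set (finite_image u finJ).
    by move=> x Cx; have [n In nx] := CI x Cx; exists n; rewrite /preimage /= ?nx.
  - move=> n x [_ Cn] Vx; have : ent_image V [set u n] x by exists (u n).
    by rewrite Viso.
have infT : infinite_set [set: nat] by exact: infinite_nat.
have [|I [V1 [_ infI oV1 V1iso]]] := sub_iso _ (fun n => (z n).1) infT.
  by left.
have [|J [V2 [JI infJ oV2 V2iso]]] := sub_iso _ (fun n => (z n).2) infI.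
  by right.
move=> /(_ J (V1 `&` V2) infJ (open_sym_entourageI oV1 oV2)).
move=> [n [m [nmJ [V1nm V2nm]]]].
have eq12 : (z n).1 = (z m).2.
  case: nmJ => k [[->|->] Jk]; last exact: V2iso.
  by apply/esym/V1iso; [exact: JI|exact: open_sym_swap].
have Urefl k x : ent_pow U k (x, x) by exact: (@ent_powW _ 0%N).
(* A point shared by two different stages would be a chain of length 0 between them. *)
case: (ltngtP n m) => [nm|mn|nm].
- by apply: (zfar n m (z n).1 (z m).2 nm); [left|right|rewrite eq12].
- by apply: (zfar m n (z m).2 (z n).1 mn); [right|left|rewrite eq12].
- by apply: (z12 n); rewrite eq12 nm.
Qed.

Lemma cond_c_a : hausdorff_space X -> beta_defavorable X ->
  cond_c R X -> cond_a R X.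
Proof.
move=> hX [D dD nwin] cX; apply: contrapT => /existsNP[U].
move=> /not_implyP[oU naX]; apply: nwin.
pose prev (s : seq (set (X * X) * (X * X))) :=
  [seq a.2.1 | a <- s] ++ [seq a.2.2 | a <- s].
have niso (s : seq X) n :
    ~ uniformly_isolated (~` ent_image (ent_pow U n.+1) [set x | x \in s]).
  move=> iso; apply: naX; exists [set x | x \in s], n.+1.
  by split=> //; exact: bourbaki_bounded_seq.
have /choice[sigma sigmaP] : forall sW : seq (set (X * X) * (X * X)) * set (X * X),
    exists z, open_sym_entourage sW.2 ->
    let F := [set x | x \in prev sW.1] in let k := (size sW.1).+1 in
    [/\ (sW.2 `&` D) z, z.1 <> z.2,
      ~ ent_image (ent_pow U k) F z.1 & ~ ent_image (ent_pow U k) F z.2].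
  move=> [s W]; have [oW|nW] := pselect (open_sym_entourage W).
    have [z zP] := beta_move hX dD oU oW (niso (prev s) (size s).+2).
    by exists z.
  (* Against an illegal [W] any point serves; the failure of (a) provides one. *)
  have [z _] := beta_move hX dD oU oU (niso [::] 1%N).
  by exists z.
exists (fun s W => sigma (s, W)) => W z oW zE.
have zP n := sigmaP (mkseq (fun i => (W i, z i)) n, W n) (oW n).
split=> [n|]; first by rewrite zE; case: (zP n).
apply: (not_alpha_wins cX oU) => [n|i n p q lin zp zq].
  by rewrite {1 2}zE; case: (zP n).
have pF : p \in prev (mkseq (fun i => (W i, z i)) n).
  have ii : i \in iota 0 n by rewrite mem_iota.
  rewrite mem_cat /mkseq -!map_comp.
  by case: zp => ->; apply/orP; [left|right]; apply/mapP; exists i.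
move=> qp; have := zP n; rewrite -zE size_mkseq /= => -[_ _ far1 far2].
by case: zq qp => -> qp; [apply: far1|apply: far2]; exists p.
Qed.

End UniformSpace.

Theorem proposition2p6 (R : realType) (X : uniformType)
    (hX : hausdorff_space X) :
  (cond_a R X -> cond_b R X) /\
  (cond_b R X -> cond_c R X) /\
  (beta_defavorable X ->
     (cond_a R X <-> cond_b R X) /\ (cond_b R X <-> cond_c R X)).
Proof.
split; first exact: cond_a_b.
split; first exact: cond_b_c.
move=> bd; have ca := cond_c_a hX bd.
split; split.
- exact: cond_a_b.
- by move=> /cond_b_c/ca.
- exact: cond_b_c.
- by move=> /ca/cond_a_b.
Qed.
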